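(* Let $\gamma>1$ and let $\widetilde\phi_\gamma(x)=x^{-\gamma}+(1-x)^{-\gamma}$. Then for every $\alpha\in[0,1]\setminus\mathbb{Q}$ we have, for Lebesgue-almost every $x\in\mathbb{T}$, $$\limsup_{N\to\infty}\frac{\widetilde\phi_\gamma(R_\alpha^N x)}{S_N(\widetilde\phi_\gamma)(x)}=\infty .$$
   Context: $\mathbb{T}=\mathbb{R}/\mathbb{Z}$ is the one-torus, identified with $[0,1)$ and equipped with Lebesgue measure; $R_\alpha(x)=x+\alpha \bmod 1$. The function $\widetilde\phi_\gamma$ is given by the stated formula for $x\in(0,1)$ (its value at $0$ is irrelevant for almost everywhere statements). For $N\ge1$ and a function $f$ on $\mathbb{T}$, $S_N(f)(x)=\sum_{k=0}^{N-1}f(R_\alpha^k x)$. *)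

(* Defs.v *)
From mathcomp Require Import all_boot all_order all_algebra.
From mathcomp Require Import all_classical all_reals all_analysis.
Set Implicit Arguments.
Unset Strict Implicit.
Unset Printing Implicit Defensive.
Import Order.TTheory GRing.Theory Num.Theory.
Import numFieldNormedType.Exports.
Local Open Scope ring_scope.

(* The torus R/Z is represented by its fundamental domain [0, 1): functions on
   the torus are functions on R of which only the values on [0, 1) matter. *)

(* x + alpha mod 1, the representative being taken in [0, 1) *)
Definition rotation {R : realType} (alpha x : R) : R :=
  (x + alpha) - (Num.floor (x + alpha))%:~R.

Definition birkhoff_sum {R : realType} (alpha : R) (f : R -> R) (N : nat)
    (x : R) : R :=
  \sum_(0 <= k < N) f (iter k (rotation alpha) x).

(* Meant for x in (0, 1). At x = 0 the library convention 0 `^ (- gamma) = 0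
   for gamma != 0 gives the junk value 1. *)
Definition tphi {R : realType} (gamma x : R) : R :=
  x `^ (- gamma) + (1 - x) `^ (- gamma).

(* Main.v *)
(** Let q be a record denominator: the distance from q alpha to the integers is
    smaller than that from k alpha for all 0 < k < q. Then the points k alpha
    mod 1, k < q, are 1/(2q)-separated, and every point of the circle is within
    3/q of one of them. If N < q and x + N alpha is within eps/q of an integer,
    separation (and gamma > 1) bounds S_N(x) by C q^gamma while
    phi(x + N alpha) >= (q/eps)^gamma, so the quotient is at least
    eps^(-gamma) / C. Density of the orbit shows that the set of such x fills a
    fixed proportion (depending on eps) of each ball of radius 4/q; by the
    Lebesgue density theorem almost every x lies in it for infinitely many q.
    Finally let eps tend to 0. *)

Require Import Defs.
From mathcomp Require Import all_boot all_order all_algebra.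
From mathcomp Require Import all_classical all_reals all_analysis.
From mathcomp Require Import measurable_realfun zify ring lra.
Import Order.TTheory GRing.Theory Num.Theory.
Import numFieldNormedType.Exports.
Local Open Scope classical_set_scope.
Local Open Scope ring_scope.

(** * Distance to the nearest integer and Dirichlet approximation *)

Definition dist_int {R : realType} (y : R) : R :=
  Num.min (y - (Num.floor y)%:~R) (1 - (y - (Num.floor y)%:~R)).

Lemma dist_int_le {R : realType} (y : R) (m : int) :
  dist_int y <= `|y - m%:~R|.
Proof.
rewrite /dist_int ge_min.
have /andP[fl fr] := Num.Theory.floor_itv y.
case: (lerP m (Num.floor y)) => hm.
  have : m%:~R <= (Num.floor y)%:~R :> R by rewrite ler_int.
  move=> h; apply/orP; left; rewrite ger0_norm; lra.
have : (Num.floor y + 1)%:~R <= m%:~R :> R by rewrite ler_int; lia.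
move: fr; rewrite intrD => fr h; apply/orP; right; rewrite ler0_norm; lra.
Qed.

Lemma dist_int_attained {R : realType} (y : R) :
  exists m : int, dist_int y = `|y - m%:~R|.
Proof.
have /andP[fl fr] := Num.Theory.floor_itv y.
rewrite /dist_int minEle; case: ifP => _.
  by exists (Num.floor y); rewrite ger0_norm; lra.
by exists (Num.floor y + 1); move: fr; rewrite intrD => fr; rewrite ler0_norm; lra.
Qed.

Lemma irrational_mulrn_neq {R : realType} (a : R) (k : nat) (m : int) :
  irrational a -> (0 < k)%N -> k%:R * a != m%:~R.
Proof.
move=> irr k0; apply/eqP => h; apply: irr; apply/rationalP; exists m, k.
by rewrite -h mulrAC mulfV ?mul1r// pnatr_eq0 -lt0n.
Qed.

Lemma dist_int_gt0 {R : realType} (a : R) (k : nat) :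
  irrational a -> (0 < k)%N -> 0 < dist_int (k%:R * a).
Proof.
move=> irr k0; have [m ->] := dist_int_attained (k%:R * a).
by rewrite normr_gt0 subr_eq0 irrational_mulrn_neq.
Qed.

(** Pigeonhole: the [Q + 1] fractional parts of [k a], [k <= Q], fall into [Q] boxes of length
    [1/Q], and two indices sharing a box differ by the required [k]. *)
Lemma dirichlet_approximation {R : realType} (a : R) (Q : nat) : (0 < Q)%N ->
  exists k : nat, (0 < k <= Q)%N /\ dist_int (k%:R * a) < Q%:R^-1.
Proof.
move=> Q0; have Q0R : 0 < Q%:R :> R by rewrite ltr0n.
pose fr (k : nat) : R := k%:R * a - (Num.floor (k%:R * a))%:~R.
have fr_itv k : 0 <= fr k < 1.
  have := Num.Theory.floor_itv (k%:R * a); rewrite intrD /fr.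
  by move=> /andP[? ?]; apply/andP; split; lra.
have box_lt k : (Num.trunc (Q%:R * fr k) < Q)%N.
  have /andP[f0 f1] := fr_itv k.
  rewrite -(ltr_nat R); apply: le_lt_trans (_ : Q%:R * fr k < _).
    by rewrite truncn_le// mulr_ge0// ltW.
  by rewrite gtr_pMr.
pose box (i : 'I_Q.+1) : 'I_Q := Ordinal (box_lt i).
have /injectivePn [i [j ij bij]] : ~~ injectiveb box.
  apply/injectiveP => /leq_card; rewrite !card_ord; lia.
wlog lt_ij : i j ij bij / (i < j)%N.
  move=> W; case: (ltngtP i j) => h; first exact: (W i j).
  - by apply: (W j i) => //; rewrite eq_sym.
  - by move/val_inj: h ij => ->; rewrite eqxx.
exists (j - i)%N; split; first by have := ltn_ord j; lia.
have := congr1 val bij => /= bE.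
have B k : (Num.trunc (Q%:R * fr k))%:R <= Q%:R * fr k < (Num.trunc (Q%:R * fr k)).+1%:R.
  by have /andP[f0 _] := fr_itv k; apply: truncn_itv; rewrite mulr_ge0// ltW.
have := B i; have := B j; rewrite -bE -natr1; set t : R := _%:R => Bj Bi.
apply: le_lt_trans (dist_int_le _ (Num.floor (j%:R * a) - Num.floor (i%:R * a))) _.
have -> : (j - i)%:R * a - (Num.floor (j%:R * a) - Num.floor (i%:R * a))%:~R
   = fr j - fr i.
  by rewrite natrB 1?ltnW// intrB /fr; ring.
rewrite -(@ltr_pM2l _ Q%:R)// mulfV ?gt_eqF// -[X in X * `|_|]gtr0_norm//.
rewrite -normrM ltr_norml mulrBr; lra.
Qed.

(** * Record denominators and the spread of the orbit *)

(* Not the record property itself (the distance from [q a] to the integers is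
   a strict minimum so far), but the bounds that it implies. *)
Definition record_denominator {R : realType} (a : R) (q : nat) : Prop :=
  [/\ (0 < q)%N,
      exists2 p : int, coprimez p q%:Z & `|q%:R * a - p%:~R| <= 2 / q%:R &
      forall k : nat, (0 < k < q)%N -> (2 * q%:R)^-1 <= dist_int (k%:R * a)].

(** Here [r] attains the least distance [d] among the multiples [1, ..., n + 1], and [q] is the
    first multiple to beat [d]. Hence [d] is also the minimum over all [0 < k < q]. *)
Lemma record_denominator_unbounded {R : realType} (a : R) (n : nat) :
  irrational a -> exists2 q : nat, (n < q)%N & record_denominator a q.
Proof.
move=> irr.
case: (@arg_minP _ R 'I_n.+1 ord0 xpredT
  (fun i : 'I_n.+1 => dist_int (i.+1%:R * a)) isT) => i _ imin.
set r := (nat_of_ord i).+1 in imin; set d := dist_int (r%:R * a) in imin.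
have d0 : 0 < d by apply: dist_int_gt0.
have exq : exists q : nat, (0 < q)%N && (dist_int (q%:R * a) < d).
  have [k [/andP[k0 _] kd]] := @dirichlet_approximation R a (Num.trunc d^-1).+1 isT.
  exists k; rewrite k0/=; apply: lt_trans kd _.
  rewrite invf_plt ?posrE ?ltr0n//.
  have d'0 : 0 <= d^-1 by rewrite invr_ge0 ltW.
  by have /andP[] := truncn_itv d'0.
have [q /andP[q0 qd] qmin] := ex_minnP exq.
have dle k : (0 < k < q)%N -> d <= dist_int (k%:R * a).
  move=> /andP[k0 kq]; rewrite leNgt; apply/negP => kd.
  by have := qmin k; rewrite k0 kd => /(_ isT); lia.
have nq : (n.+1 < q)%N.
  rewrite ltnNge; apply/negP => qn.
  have qn' : (q.-1 < n.+1)%N by lia.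
  have := imin (Ordinal qn') isT; rewrite /= prednK// leNgt; by rewrite qd.
have rq : (0 < r < q)%N by have := ltn_ord i; rewrite /r; lia.
have q0R : 0 < q%:R :> R by rewrite ltr0n.
have [p pE] := dist_int_attained (q%:R * a).
have [p0 p0E] := dist_int_attained (r%:R * a).
have rltq : r%:R < q%:R :> R by rewrite ltr_nat; lia.
have r0R : 0 < r%:R :> R by rewrite ltr0n.
exists q; [lia | split => //].
- exists p.
    (* Dividing by a common factor of p and q would beat the record. *)
    rewrite /coprimez; apply/negPn/negP => g1.
    have [q' qE] := dvdnP (dvdn_gcdr `|p|%N q).
    have /dvdzP[p' p'E] : (gcdz p q%:Z %| p)%Z by apply: dvdz_gcdl.
    set g := gcdn `|p| q in qE.
    have gE : gcdz p q%:Z = g%:Z by [].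
    have g0 : (0 < g)%N by rewrite gcdn_gt0 q0 orbT.
    have g2 : (1 < g)%N by move: g1; rewrite gE; lia.
    rewrite gE in p'E.
    have q'0 : (0 < q' < q)%N by rewrite qE; nia.
    have := dle q' q'0; have := dist_int_le (q'%:R * a) p'.
    have : `|q%:R * a - p%:~R| = g%:R * `|q'%:R * a - p'%:~R|.
      rewrite -[g%:R]ger0_norm// -normrM; congr (`|_|).
      rewrite qE p'E intrM natrM -pmulrn; ring.
    have : 2 <= g%:R :> R by rewrite (ler_nat R 2).
    have := normr_ge0 (q'%:R * a - p'%:~R).
    by move: qd; rewrite pE; nra.
  rewrite -pE; apply: ltW; apply: lt_le_trans qd _.
  (* Dirichlet applied to [q - 1] yields a multiplier below [q], so [d < 1/(q - 1) <= 2/q]. *)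
  have q10 : (0 < q.-1)%N by lia.
  have [k [/andP[k0 kq] kd]] := @dirichlet_approximation R a _ q10.
  have kq' : (0 < k < q)%N by lia.
  apply: le_trans (dle k kq') _; apply: le_trans (ltW kd) _.
  rewrite ler_pdivlMr// ler_pdivrMl ?ltr0n// -natrM ler_nat; lia.
- move=> k kq; apply: le_trans (dle k kq).
  rewrite invf_ple ?posrE ?mulr_gt0//.
  (* The determinant of [p/q] and [p0/r] is an integer, nonzero because [r < q] and the distance at
     [q] is below [d]. It equals [q (r a - p0) - r (q a - p)], so [1 <= 2 q d]. *)
  have detN : p * r%:Z - p0 * q%:Z != 0.
    apply/eqP => det0.
    have detR : p%:~R * r%:R = p0%:~R * q%:R :> R.
      by have := congr1 (fun z : int => z%:~R : R) det0; rewrite intrB !intrM -!pmulrn; lra.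
    have : r%:R * `|q%:R * a - p%:~R| = q%:R * `|r%:R * a - p0%:~R|.
      rewrite -[in LHS](@gtr0_norm _ r%:R)// -[in RHS](@gtr0_norm _ q%:R)// -!normrM.
      congr (`|_|); lra.
    by rewrite -pE -p0E -/d; nra.
  have det1 : 1 <= `|(p * r%:Z - p0 * q%:Z)%:~R| :> R.
    by rewrite -intr_norm ler1z; lia.
  rewrite -[leLHS]mul1r ler_pdivrMr//.
  apply: le_trans det1 _.
  rewrite intrB !intrM -!pmulrn.
  have -> : p%:~R * r%:R - p0%:~R * q%:R =
     q%:R * (r%:R * a - p0%:~R) - r%:R * (q%:R * a - p%:~R) by ring.
  apply: le_trans (ler_normB _ _) _.
  rewrite !normrM !(@gtr0_norm _ _%:R)// -pE -p0E -/d; nra.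
Qed.

(* Bezout: the points [m - N a], [N < q], follow the grid [j / q]. *)
Lemma record_denominator_dense {R : realType} (a : R) (q : nat) (x : R) :
  record_denominator a q ->
  exists (N : nat) (m : int), (N < q)%N /\ `|x - (m%:~R - N%:R * a)| <= 3 / q%:R.
Proof.
move=> [q0 [p copq pE] _]; have q0R : 0 < q%:R :> R by rewrite ltr0n.
have [u [v uvE]] := Bezoutz p q%:Z.
move: copq uvE; rewrite /coprimez => /eqP-> uvE.
pose j := Num.floor (q%:R * x).
have /andP[jl jr] := Num.Theory.floor_itv (q%:R * x).
pose t := (- j * u)%R.
pose N := `|(t %% q%:Z)%Z|%N.
have NE : N%:Z = (t %% q%:Z)%Z by rewrite /N gez0_abs// modz_ge0//; lia.
have tE := divz_eq t q%:Z.
set w := (t %/ q%:Z)%Z in tE.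
(* N = t - w q; j = j u p + j v q = - t p + j v q = -N p + (j v - w p) q *)
exists N, (j * v - w * p); split.
  by rewrite -ltz_nat NE ltz_pmod.
have jE : j = (j * v - w * p) * q%:Z - N%:Z * p.
  have : t = w * q%:Z + N%:Z by rewrite NE.
  rewrite /t => tE'; rewrite -{1}[j]mulr1 -uvE.
  have -> : N%:Z = - j * u - w * q%:Z by rewrite tE'; ring.
  ring.
set m := (j * v - w * p) in jE *.
have jER : j%:~R = m%:~R * q%:R - N%:R * p%:~R :> R.
  by rewrite {1}jE intrB !intrM -!pmulrn.
rewrite ler_pdivlMr// -[X in _ * X]gtr0_norm// -normrM.
(* Rounding [q x] down to [j] costs at most 1, and replacing [q a] by [p] costs at most
   [N * 2/q <= 2]; hence the constant 3. *)
have -> : (x - (m%:~R - N%:R * a)) * q%:R =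
    (q%:R * x - j%:~R) + N%:R * (q%:R * a - p%:~R) by rewrite jER; ring.
apply: le_trans (ler_normD _ _) _.
have : `|q%:R * x - j%:~R| <= 1.
  by move: jr; rewrite intrD => jr; rewrite ger0_norm; lra.
have : `|N%:R * (q%:R * a - p%:~R)| <= 2.
  rewrite normrM ger0_norm//.
  have NqR : N%:R <= q%:R :> R.
    by rewrite ler_nat ltnW// -ltz_nat NE ltz_pmod.
  apply: le_trans (ler_pM _ _ NqR pE) _ => //.
  by rewrite mulrCA divff ?mulr1// gt_eqF.
by lra.
Qed.

(** * Sums of negative powers over separated points *)

Lemma le_powRN {R : realType} (g x y : R) : 0 <= g -> 0 < x -> x <= y ->
  y `^ (- g) <= x `^ (- g).
Proof.
move=> g0 x0 xy; have y0 := lt_le_trans x0 xy.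
rewrite !powRN lef_pV2 ?posrE ?powR_gt0//.
by rewrite ge0_ler_powR// nnegrE ltW.
Qed.

(** Cauchy condensation: the terms [2n + 2] and [2n + 3] together are at most [r = 2^(1 - g) < 1]
    times the term [n + 1], so [h n <= h (2n + 1) <= 1 + r * h n]. *)
Lemma riemann_sum_bounded {R : realType} (g : R) : 1 < g ->
  exists C : R, forall n : nat, \sum_(i < n) i.+1%:R `^ (- g) <= C.
Proof.
move=> g1; pose r : R := 2 * 2 `^ (- g).
have g0 : 0 <= g by lra.
have r1 : r < 1.
  rewrite /r powRN ltr_pdivrMr ?powR_gt0// mul1r -[ltLHS]powRr1//.
  by rewrite /powR gt_eqF// ltr_expR ltr_pM2r// ln_gt0// ltr1n.
pose h n : R := \sum_(i < n) i.+1%:R `^ (- g).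
have hS n : h n.+1 = h n + n.+1%:R `^ (- g) by rewrite /h big_ord_recr.
have h_homo m n : (m <= n)%N -> h m <= h n.
  elim: n => [|n IH]; first by rewrite leqn0 => /eqP->.
  rewrite leq_eqVlt => /predU1P[->//|/IH/le_trans]; apply.
  by rewrite hS lerDl powR_ge0.
have h2 n : h n.*2.+1 <= 1 + r * h n.
  elim: n => [|n IH]; first by rewrite hS /h !big_ord0 add0r mulr0 addr0 powR1.
  rewrite doubleS hS hS (hS n) mulrDr.
  have -> : r * n.+1%:R `^ (- g) = n.*2.+2%:R `^ (- g) *+ 2.
    by rewrite /r -mulrA -powRM// -natrM mul2n doubleS mulr_natl.
  have : n.*2.+3%:R `^ (- g) <= n.*2.+2%:R `^ (- g) :> R.
    by rewrite le_powRN ?ltr0n// ler_nat.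
  by rewrite mulr2n; lra.
exists (1 - r)^-1 => n; rewrite -/(h n) -[leRHS]mul1r ler_pdivlMr ?subr_gt0//.
have : h n <= h n.*2.+1 by apply: h_homo; lia.
by have := h2 n; nra.
Qed.

(** Separation puts at most one [z k] in each cell [[j s, (j + 1) s)], which compares the sum with
    that of [(j s)^(-g)]. In cell 0 the bound [s / 2 <= z k] takes over. *)
Lemma separated_sum_bounded {R : realType} (g : R) : 1 < g ->
  exists2 C : R, 0 < C & forall (N : nat) (z : nat -> R) (s : R), 0 < s ->
    (forall k, (k < N)%N -> s / 2 <= z k) ->
    (forall k l, (k < l < N)%N -> s <= `|z k - z l|) ->
    \sum_(k < N) z k `^ (- g) <= C * s `^ (- g).
Proof.
move=> g1; have [C0 C0P] := @riemann_sum_bounded R g g1.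
have g0 : 0 <= g by lra.
exists (2^-1 `^ (- g) + C0).
  have := C0P 0%N; rewrite big_ord0 => ?.
  by rewrite ltr_wpDr// powR_gt0.
move=> N z s s0 zge zsep.
pose w (i : nat) : R := if i is j.+1 then j.+1%:R `^ (- g) else 2^-1 `^ (- g).
pose cell k := Num.trunc (z k / s).
have z0 k : (k < N)%N -> 0 < z k by move=> /zge; lra.
have cellP k : (k < N)%N -> (cell k)%:R * s <= z k < (cell k)%:R * s + s.
  move=> kN; have zs0 : 0 <= z k / s by rewrite divr_ge0 ?ltW ?z0.
  have := truncn_itv zs0; rewrite -/(cell k) ler_pdivlMr// ltr_pdivrMr//.
  by rewrite -natr1 mulrDl mul1r.
have zw k : (k < N)%N -> z k `^ (- g) <= w (cell k) * s `^ (- g).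
  move=> kN; have /andP[cl _] := cellP k kN.
  case E: (cell k) cl => [|j] cl /=.
    rewrite -powRM ?(ltW s0)// le_powRN//; first by rewrite mulr_gt0.
    by rewrite mulrC zge.
  by rewrite -powRM ?(ltW s0)// le_powRN// mulr_gt0// ltr0n.
pose M := (\max_(k < N) cell k)%N.
have cellM (k : 'I_N) : (cell k < M.+1)%N by rewrite ltnS leq_bigmax.
pose c k : 'I_M.+1 := Ordinal (cellM k).
have c_inj : {in [set: 'I_N]%SET &, injective c}.
  move=> k l _ _ /(congr1 val)/= ckl; apply/val_inj => /=; apply/eqP.
  wlog kl : k l ckl / (k < l)%N.
    move=> W; case: (ltngtP k l) => // h.
      by move: (W k l ckl h); rewrite ltn_eqF.
    by move: (W l k (esym ckl) h); rewrite ltn_eqF.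
  have := zsep k l; rewrite kl ltn_ord => /(_ isT); rewrite leNgt => /negP[].
  have := cellP k (ltn_ord k); have := cellP l (ltn_ord l).
  by rewrite ckl ltr_norml; lra.
apply: (@le_trans _ _ (\sum_(k < N) w (c k) * s `^ (- g))).
  by apply: ler_sum => k _; exact: zw.
rewrite -mulr_suml ler_wpM2r ?powR_ge0//.
have w0 i : 0 <= w i by case: i => [|i]; rewrite powR_ge0.
apply: (@le_trans _ _ (\sum_(i < M.+1) w i)).
  have -> : \sum_(k < N) w (c k) = \sum_(i in c @: [set: 'I_N]%SET) w i.
    by rewrite big_imset//=; apply: eq_bigl => k; rewrite inE.
  by rewrite big_mkcond/=; apply: ler_sum => i _; case: ifP.
rewrite big_ord_recl/= lerD2l.
by apply: le_trans (C0P M).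
Qed.

(** * Birkhoff sums before a close approach to 0 *)

Lemma iter_rotation {R : realType} (a x : R) (k : nat) : 0 <= x < 1 ->
  iter k (rotation a) x = (x + k%:R * a) - (Num.floor (x + k%:R * a))%:~R.
Proof.
move=> x01; elim: k => [|k IH].
  rewrite /= mul0r addr0.
  have /Num.Theory.floor_def -> : 0%:~R <= x < (0 + 1)%:~R by rewrite add0r.
  by rewrite subr0.
rewrite iterS IH /rotation.
have -> : x + k%:R * a - (Num.floor (x + k%:R * a))%:~R + a =
   x + k.+1%:R * a - (Num.floor (x + k%:R * a))%:~R.
  by rewrite -natr1; ring.
set y := x + k.+1%:R * a; set j := Num.floor (x + k%:R * a).
have -> : Num.floor (y - j%:~R) = Num.floor y - j.
  apply: Num.Theory.floor_def; have := Num.Theory.floor_itv y.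
  by rewrite !intrD rmorphN/=; lra.
by rewrite intrB; ring.
Qed.

(** With [s = 1/(2q)], the orbit points [z k] and their reflections [1 - z k] both satisfy the
    hypotheses of [separated_sum_bounded], one family for each singularity of [tphi]. *)
Lemma birkhoff_sum_tphi_bounded {R : realType} (g : R) : 1 < g ->
  exists2 C : R, 0 < C & forall (a x : R) (q N : nat) (m : int),
    record_denominator a q -> (N < q)%N -> 0 <= x < 1 ->
    `|x - (m%:~R - N%:R * a)| <= (4 * q%:R)^-1 ->
    birkhoff_sum a (tphi g) N x <= C * q%:R `^ g.
Proof.
move=> g1; have [C C0 CP] := @separated_sum_bounded R g g1.
have g0 : 0 <= g by lra.
exists (C * 2^-1 `^ (- g) *+ 2).
  by rewrite pmulrn_lgt0// mulr_gt0// powR_gt0.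
move=> a x q N m [q0 _ qsep] Nq x01 xm.
have q0R : 0 < q%:R :> R by rewrite ltr0n.
pose z k := x + k%:R * a - (Num.floor (x + k%:R * a))%:~R.
pose s : R := (2 * q%:R)^-1.
have s0 : 0 < s by rewrite invr_gt0 mulr_gt0.
have xm' : `|x - (m%:~R - N%:R * a)| <= s / 2.
  by rewrite (_ : s / 2 = (4 * q%:R)^-1)// /s; field; rewrite gt_eqF.
have z01 k : 0 <= z k < 1.
  have := Num.Theory.floor_itv (x + k%:R * a).
  by rewrite /z intrD; lra.
(* The point [x + N a] is within [s/2] of [m], while [(N - k) a] is at least [s] away from every
   integer. *)
have far k (j : int) : (k < N)%N -> s / 2 <= `|x + k%:R * a - j%:~R|.
  move=> kN; have kq : (0 < N - k < q)%N by lia.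
  have := le_trans (qsep _ kq) (dist_int_le _ (m - j)); rewrite -/s => h.
  have := ler_normB (x - (m%:~R - N%:R * a)) (x + k%:R * a - j%:~R).
  rewrite (_ : x - (m%:~R - N%:R * a) - (x + k%:R * a - j%:~R) =
    (N - k)%:R * a - (m - j)%:~R); first by lra.
  rewrite (natrB R (ltnW kN)) intrB; ring.
have zfar k : (k < N)%N -> s / 2 <= z k.
  move=> /(far k (Num.floor (x + k%:R * a))); rewrite -/(z k).
  by have /andP[? ?] := z01 k; rewrite ger0_norm.
have zfar' k : (k < N)%N -> s / 2 <= 1 - z k.
  move=> /(far k (Num.floor (x + k%:R * a) + 1)); rewrite intrD opprD addrA -/(z k).
  by have /andP[? ?] := z01 k; rewrite ler0_norm; lra.
have zsep k l : (k < l < N)%N -> s <= `|z k - z l|.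
  move=> kl; have klq : (0 < l - k < q)%N by lia.
  have := le_trans (qsep _ klq)
    (dist_int_le _ (Num.floor (x + l%:R * a) - Num.floor (x + k%:R * a))).
  rewrite -/s distrC; congr (_ <= `|_|).
  by rewrite natrB 1?intrB /z; [ring | lia].
have zsep' k l : (k < l < N)%N -> s <= `|(1 - z k) - (1 - z l)|.
  move=> kl; rewrite (_ : 1 - z k - (1 - z l) = z l - z k); last by ring.
  by rewrite distrC zsep.
have -> : C * 2^-1 `^ (- g) *+ 2 * q%:R `^ g = C * s `^ (- g) + C * s `^ (- g).
  rewrite -mulr2n mulrnAl -mulrA; congr (_ * _ *+ 2).
  by rewrite /s invfM powRM ?invr_ge0// -[q%:R^-1]powR_inv1// -powRrM mulrNN mul1r.
rewrite /birkhoff_sum big_mkord.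
rewrite (eq_bigr (fun k : 'I_N => z k `^ (- g) + (1 - z k) `^ (- g))); last first.
  by move=> k _; rewrite iter_rotation.
rewrite big_split/=; apply: lerD; first exact: (CP N z).
exact: (CP N (fun k => 1 - z k)).
Qed.

(** * Negligibility by Lebesgue density *)

(* The complement of this set fills a fixed proportion of every ball of radius
   [4 / q], so the set contains none of its density points. *)
Lemma never_close_negligible {R : realType} (a e : R) (n : nat) :
  irrational a -> 0 < e <= 1 ->
  (@lebesgue_measure R).-negligible
    [set x | forall (q N : nat) (m : int), record_denominator a q ->
      (n < q)%N -> (N < q)%N -> e / q%:R <= `|x - (m%:~R - N%:R * a)|].
Proof.
move=> irr /andP[e0 e1]; set F := (X in negligible _ X).
(* As the complement of a union of open balls, [F] is closed, hence measurable. *)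
have FE : F = ~` \bigcup_(t in [set t : nat * nat * int |
      [/\ record_denominator a t.1.1, (n < t.1.1)%N & (t.1.2 < t.1.1)%N]])
    ball (t.2%:~R - t.1.2%:R * a) (e / t.1.1%:R).
  apply/seteqP; split => x /=.
    move=> Fx [[[q N] m] /= [rq nq Nq]]; rewrite /ball/= distrC ltNge.
    by rewrite Fx.
  move=> H q N m rq nq Nq; rewrite leNgt; apply/negP => lt; apply: H.
  by exists (q, N, m) => //=; rewrite /ball/= distrC.
have mF : measurable F.
  rewrite FE; apply: measurableC; apply: open_measurable.
  by apply: bigcup_open => t _; exact: ball_open.
have := lebesgue_density mF; apply: negligibleS => x Fx /= dens.
(* The threshold is [1 - e/4] because a ball of radius [e/q] missing [F] has share exactly [e/4] of
   a ball of radius [4/q]. *)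
have nearr : \forall r \near 0^'+, ((1 - e / 4)%:E <
    lebesgue_measure (F `&` ball x r) * (lebesgue_measure (ball x r))^-1)%E.
  move: dens; rewrite indicE mem_set// => /(_ [set y | ((1 - e / 4)%:E < y)%E]); apply.
  by apply: open_nbhs_nbhs; split; [exact: open_ereal_gt_ereal | rewrite /= lte_fin; lra].
have [d /= d0 dP] := nearr.
have [q nq rq] := @record_denominator_unbounded R a (n + Num.trunc (4 / d)) irr.
have [N [m [Nq xN]]] := @record_denominator_dense R a q x rq.
have q0R : 0 < q%:R :> R by rewrite ltr0n; lia.
pose r : R := 4 / q%:R.
have r0 : 0 < r by rewrite divr_gt0.
have rd : r < d.
  have d4 : 0 <= 4 / d by rewrite divr_ge0// ltW.
  have /andP[_ tr] := truncn_itv d4.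
  rewrite /r ltr_pdivrMr// mulrC -ltr_pdivrMr//; apply: lt_le_trans tr _.
  by rewrite ler_nat; lia.
have := dP r; rewrite /= sub0r normrN gtr0_norm// => /(_ rd r0).
set y := m%:~R - N%:R * a in xN.
(* The radius [4/q] leaves room for [3/q] from [x] to [y] and [e/q <= 1/q] around [y]. *)
have sub : (F `&` ball x r) `|` ball y (e / q%:R) `<=` ball x r.
  move=> z [[]//|]; rewrite /ball/= => yz.
  have -> : x - z = (x - y) + (y - z) by ring.
  apply: le_lt_trans (ler_normD _ _) _.
  have : e / q%:R <= 1 / q%:R by rewrite ler_pM2r ?invr_gt0.
  have : r = 3 / q%:R + 1 / q%:R by rewrite /r; field; rewrite gt_eqF.
  lra.
have disj : (F `&` ball x r) `&` ball y (e / q%:R) = set0.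
  apply/seteqP; split => z //= [[Fz _]]; rewrite /ball/= distrC ltNge.
  by rewrite Fz//; lia.
have mball (c s : R) : measurable (ball c s) by exact: measurable_ball.
have mFB : measurable (F `&` ball x r) by exact: measurableI.
have eq0 : 0 <= e / q%:R by rewrite divr_ge0// ltW.
have : (lebesgue_measure (F `&` ball x r) + (e / q%:R *+ 2)%:E <= (r *+ 2)%:E)%E.
  rewrite -(lebesgue_measure_ball y eq0) -(lebesgue_measure_ball x (ltW r0)).
  rewrite -measureU//; last exact: mball.
  apply: le_measure => //; rewrite inE; last exact: mball.
  by apply: measurableU; [exact: mFB | exact: mball].
rewrite lebesgue_measure_ball ?(ltW r0)//.
have r2 : r *+ 2 != 0 by rewrite mulrn_eq0/= gt_eqF.
have : (0 <= lebesgue_measure (F `&` ball x r))%E by exact: measure_ge0.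
case: (lebesgue_measure (F `&` ball x r)) => [t| |]//=.
rewrite inver (negbTE r2) -EFinD -EFinM !lee_fin lte_fin => t0 tle.
rewrite ltr_pdivlMr ?mulrn_wgt0//.
have -> : (1 - e / 4) * (r *+ 2) = r *+ 2 - e / q%:R *+ 2.
  by rewrite /r; field; rewrite gt_eqF.
lra.
Qed.

(** * Divergence of the limit superior almost everywhere *)

Lemma limn_esup_eqy {R : realType} (u : R^nat) :
  (forall (A : R) (n : nat), exists2 N : nat, (n <= N)%N & A <= u N) ->
  limn_esup (fun n => (u n)%:E) = +oo%E.
Proof.
move=> H; rewrite limn_esup_lim.
have -> : esups (fun n => (u n)%:E) = cst +oo%E.
  apply/funext => n; apply/eqyP => A A0.
  have [N nN AN] := H A n.
  by apply: le_ereal_sup_tmp; exists (u N)%:E; [exists N | rewrite lee_fin].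
by rewrite lim_cst.
Qed.

Theorem theorem1p4 (R : realType) (gamma : R) (hgamma : 1 < gamma) (alpha : R)
    (halpha01 : 0 <= alpha <= 1) (halpha : irrational alpha) :
  {ae (@lebesgue_measure R), forall x : R, 0 <= x < 1 ->
    limn_esup (fun N : nat =>
      (tphi gamma (iter N (rotation alpha) x) /
       birkhoff_sum alpha (tphi gamma) N x)%:E) = +oo%E}.
Proof.
have [C C0 CP] := @birkhoff_sum_tphi_bounded R gamma hgamma.
have g0 : 0 <= gamma by lra.
(* The closeness [1/(i + 4)] is at most [1/4], as the Birkhoff sum bound requires, and tends to 0
   along a countable family. *)
pose F (i n : nat) := [set x : R | forall (q N : nat) (m : int),
  record_denominator alpha q -> (n < q)%N -> (N < q)%N ->
  i.+4%:R^-1 / q%:R <= `|x - (m%:~R - N%:R * alpha)|].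
(* The countably many points whose orbit meets an integer are discarded, so that all distances below
   are positive. *)
pose orbit : set R := range (fun t : nat * int => t.2%:~R - t.1%:R * alpha).
have Fneg : (@lebesgue_measure R).-negligible (\bigcup_i \bigcup_n F i n).
  apply: negligible_bigcup => i; apply: negligible_bigcup => n.
  apply: never_close_negligible => //.
  by rewrite invr_gt0 ltr0n/= invf_le1 ?ler1n ?ltr0n.
have orbit_neg : (@lebesgue_measure R).-negligible orbit.
  have co : countable orbit by apply: card_le_trans (card_image_le _ _) _; exact: countableP.
  apply/negligibleP; last exact: countable_lebesgue_measure0.
  by apply: countable_measurable => // t; exact: measurable_set1.
apply: negligibleS (negligibleU Fneg orbit_neg) => x /= bad.
apply: contrapT => /not_orP[nF norb]; apply: bad => x01.
apply: limn_esup_eqy => A n.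
have dist_gt0 k : 0 < dist_int (x + k%:R * alpha).
  have [m ->] := dist_int_attained (x + k%:R * alpha).
  rewrite normr_gt0 subr_eq0; apply/eqP => xE; apply: norb.
  by exists (k, m) => //=; rewrite -xE addrK.
(* This [d] will force [N > n]: a visit within [1/((i + 4) q)] of an integer, with [q > 1/d], is
   closer than all those up to time [n]. *)
have [d d0 dP] : exists2 d : R, 0 < d &
    forall k, (k < n.+1)%N -> d <= dist_int (x + k%:R * alpha).
  elim: n.+1 => [|k [d d0 dP]]; first by exists 1.
  exists (Num.min d (dist_int (x + k%:R * alpha))); first by rewrite lt_min d0 dist_gt0.
  move=> l; rewrite ltnS leq_eqVlt => /predU1P[->|lk].
    by rewrite ge_min lexx orbT.
  by rewrite ge_min dP.
(* The quotient will be at least [(i + 4)^gamma / C], and this choice of [i] makes that at least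
   [|A|]. *)
pose i := Num.trunc (C * `|A|).
have iE : C * `|A| <= i.+4%:R `^ gamma.
  have CA : 0 <= C * `|A| by rewrite mulr_ge0// ltW.
  have /andP[_ /ltW tr] := truncn_itv CA.
  apply: le_trans tr _; apply: le_trans (_ : i.+4%:R <= _).
    by rewrite ler_nat; lia.
  by rewrite le1r_powR ?ler1n ?ltW.
have : ~ F i (Num.trunc d^-1) x by move=> Fx; apply: nF; exists i => //; exists (Num.trunc d^-1).
move=> /existsNP[q] /existsNP[N] /existsNP[m] /not_implyP[rq].
move=> /not_implyP[dq] /not_implyP[Nq] /negP; rewrite -ltNge => close.
have q0R : 0 < q%:R :> R by rewrite ltr0n; lia.
have i0R : 0 < i.+4%:R :> R by rewrite ltr0n.
have dist_lt : dist_int (x + N%:R * alpha) < i.+4%:R^-1 / q%:R.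
  apply: le_lt_trans (dist_int_le _ m) _.
  by rewrite (_ : x + _ - _ = x - (m%:~R - N%:R * alpha)) //; ring.
have nN : (n < N)%N.
  rewrite ltnNge; apply/negP => Nn; have := dP N Nn; apply/negP; rewrite -ltNge.
  apply: lt_trans dist_lt _.
  rewrite -invfM invf_plt ?posrE ?mulr_gt0//.
  have d'0 : 0 <= d^-1 by rewrite invr_ge0 ltW.
  have /andP[_ tr] := truncn_itv d'0.
  apply: lt_le_trans tr _; rewrite -natrM ler_nat; nia.
exists N; first exact: ltnW.
(* As [N > 0], the sum contains the term at [x], which is positive already through
   [(1 - x)^(-gamma)]. *)
have S0 : 0 < birkhoff_sum alpha (tphi gamma) N x.
  have tphi_ge0 y : 0 <= tphi gamma y by rewrite addr_ge0 ?powR_ge0.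
  rewrite /birkhoff_sum -(prednK (leq_ltn_trans (leq0n n) nN)).
  rewrite big_nat_recl//= ltr_pwDl//; last exact: sumr_ge0.
  by rewrite ltr_wpDl ?powR_ge0// powR_gt0// subr_gt0; case/andP: x01.
have Sle : birkhoff_sum alpha (tphi gamma) N x <= C * q%:R `^ gamma.
  apply: (CP alpha x q N m) => //; apply: le_trans (ltW close) _.
  by rewrite -invfM lef_pV2 ?posrE ?mulr_gt0// ler_pM2r// ler_nat.
(* The distance to the integers is [z] or [1 - z], and the corresponding summand of [tphi] alone
   gives the bound. *)
have phige : i.+4%:R `^ gamma * q%:R `^ gamma <= tphi gamma (iter N (rotation alpha) x).
  rewrite iter_rotation//; set z := _ - _.
  have -> : i.+4%:R `^ gamma * q%:R `^ gamma = (i.+4%:R^-1 / q%:R) `^ (- gamma).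
    by rewrite -invfM -powR_inv1 ?mulr_ge0 ?ltW// -powRrM mulrNN mul1r powRM ?ltW.
  have := dist_gt0 N; move: dist_lt; rewrite /dist_int -/z lt_min gt_min.
  move=> /orP[h|h] /andP[z0 z1].
    by rewrite /tphi ler_wpDr ?powR_ge0// le_powRN// ltW.
  by rewrite /tphi ler_wpDl ?powR_ge0// le_powRN// ltW.
rewrite ler_pdivlMr//; apply: le_trans phige.
apply: le_trans (_ : `|A| * (C * q%:R `^ gamma) <= _).
  by apply: le_trans (ler_wpM2l (normr_ge0 A) Sle); rewrite ler_wpM2r ?ler_norm ?ltW.
by rewrite mulrA [_ * C]mulrC ler_wpM2r ?powR_ge0.
Qed.
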